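(* Let $S$ be an infinite set. Then the distance function $d$ on the set of simplicial complexes over $S$ takes all possible values inside $[0,1]$: for every $\alpha\in[0,1]$ there exist simplicial complexes $\mathcal{K}_1,\mathcal{K}_2$ over $S$ with $d(\mathcal{K}_1,\mathcal{K}_2)=\alpha$.
   Context: $\mathcal{P}_f^*(S)$ is the collection of all non-empty finite subsets of $S$. A simplicial complex over $S$ is a non-empty collection $\mathcal{K}\subset\mathcal{P}_f^*(S)$ such that every non-empty subset of an element of $\mathcal{K}$ belongs to $\mathcal{K}$. $\Omega=[0,1]$ with Lebesgue measure $\lambda$. $L(\mathcal{K})$ is the set of measurable maps $f:\Omega\to S$, identified when equal almost everywhere, such that $f(\Omega)\in\mathcal{K}$, where $f(\Omega)$ denotes the set $\{s\in S : \lambda(f^{-1}(s))>0\}$ and $f$ takes its values in this set almost everywhere. The metric is $d(f,g)=\lambda(\{t\in\Omega : f(t)\neq g(t)\})$. The distance between simplicial complexes is the Hausdorff distance $d(\mathcal{K}_1,\mathcal{K}_2)=\max(\delta(\mathcal{K}_1,\mathcal{K}_2),\delta(\mathcal{K}_2,\mathcal{K}_1))$ with $\delta(\mathcal{K}_1,\mathcal{K}_2)=\sup_{f\in L(\mathcal{K}_1)}\inf_{g\in L(\mathcal{K}_2)}d(f,g)$. *)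

(* Defs.v *)
From HB Require Import structures.
From mathcomp Require Import all_boot all_order all_algebra.
From mathcomp Require Import all_classical all_reals all_analysis.

Set Implicit Arguments.
Unset Strict Implicit.
Unset Printing Implicit Defensive.
Import Order.TTheory GRing.Theory Num.Theory.
Import numFieldNormedType.Exports.

Local Open Scope classical_set_scope.
Local Open Scope ring_scope.

Record simplicial_complex (S : Type) := SimplicialComplex {
  faces : set (set S) ;
  faces_neq0 : faces !=set0 ;
  face_finite : forall F, faces F -> finite_set F ;
  face_neq0 : forall F, faces F -> F !=set0 ;
  face_sub : forall F G, faces F -> G `<=` F -> G !=set0 -> faces G
}.

(* The set of vertices carries the discrete sigma-algebra. *)
Definition discrete (S : Type) : Type := S.
HB.instance Definition _ (S : pointedType) := Pointed.on (discrete S).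
HB.instance Definition _ (S : pointedType) :=
  @isMeasurable.Build default_measure_display (discrete S)
    discrete_measurable discrete_measurable0
    discrete_measurableC discrete_measurableU.

(* The line with its sigma-algebra of Lebesgue (not merely Borel) measurable
   sets. *)
Definition lebesgueR (R : realType) : measurableType _ :=
  caratheodory_type ((@wlength R idfun)^*)%mu.

Lemma measurable_unit_interval (R : realType) :
  measurable (`[0%R, 1%R]%classic : set (lebesgueR R)).
Proof.
apply: sub_caratheodory.
exact: (@measurable_itv R `[0%R, 1%R]).
Qed.

(* The probability space Omega = [0, 1] is encoded as the line equipped with
   Lebesgue measure restricted to [0, 1]: modulo almost everywhere equality for
   this measure, the values of a map outside [0, 1] are irrelevant. *)
Definition lambda (R : realType) : set (lebesgueR R) -> \bar R :=
  mrestr (@completed_lebesgue_measure R) (@measurable_unit_interval R).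
HB.instance Definition _ (R : realType) := Measure.on (@lambda R).
Arguments lambda : clear implicits.

(* Measurable maps Omega -> S modulo almost everywhere equality; an element
   coerces to one of its representatives. *)
Notation Lmap R S := {mfun_ (lambda R), lebesgueR R >-> discrete S}.

Section Distance.
Context {R : realType} {S : pointedType}.

Definition essential_image (f : lebesgueR R -> discrete S) : set S :=
  [set s | (0 < lambda R (f @^-1` [set s]))%E].

Definition L (K : simplicial_complex S) : set (Lmap R S) :=
  [set f : Lmap R S | faces K (essential_image f) /\
           {ae lambda R, forall t, essential_image f (f t)}].

Definition dist_map (f g : lebesgueR R -> discrete S) : \bar R :=
  lambda R [set t | f t <> g t].

Definition delta (K1 K2 : simplicial_complex S) : \bar R :=
  ereal_sup [set ereal_inf [set dist_map f g | g in L K2] | f in L K1].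

Definition dist (K1 K2 : simplicial_complex S) : \bar R :=
  Order.max (delta K1 K2) (delta K2 K1).

End Distance.
Arguments dist R {S} K1 K2.

(* essential_image, L and dist_map do not depend on representatives. *)
Section WellDefined.
Context {R : realType} {S : pointedType}.
Implicit Types f g : lebesgueR R -> discrete S.

Lemma lambda_ae_eq (A B : set (lebesgueR R)) :
  (\forall t \ae lambda R, A t <-> B t) -> lambda R A = lambda R B.
Proof.
have le (C D : set (lebesgueR R)) :
    (\forall t \ae lambda R, C t <-> D t) -> (lambda R C <= lambda R D)%E.
  move=> -[N [mN N0 sN]].
  have CDN : C `<=` D `|` N.
    by move=> t Ct; apply/or_asboolP; case: asboolP => //= nDt;
      apply/asboolP/sN => /= -[/(_ Ct)].
  have le1 : (lambda R C <= lambda R (D `|` N))%E.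
    by rewrite /lambda /mrestr; apply: le_outer_measure; exact: setSI.
  apply: (le_trans le1); rewrite -[leRHS]adde0 -[X in (_ + X)%E]N0.
  rewrite /lambda /mrestr setIUl; exact: outer_measureU2.
by move=> AB; apply/eqP; rewrite eq_le !le//; apply: filterS AB => t [].
Qed.

Lemma essential_image_ae_eq f g :
  f = g %[ae lambda R] -> essential_image f = essential_image g.
Proof.
move=> fg; apply/seteqP; split=> s; rewrite /essential_image /=;
  by rewrite (@lambda_ae_eq (f @^-1` [set s]) (g @^-1` [set s]))//;
     apply: filterS fg => t /= ->.
Qed.

Lemma dist_map_ae_eq f f' g g' :
  f = f' %[ae lambda R] -> g = g' %[ae lambda R] ->
  dist_map f g = dist_map f' g'.
Proof.
move=> ff' gg'; apply: lambda_ae_eq; apply: filterS2 ff' gg' => t /=.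
by move=> -> // ->.
Qed.

End WellDefined.

(* Main.v *)
From HB Require Import structures.
Require Import Defs.
From mathcomp Require Import all_boot all_order all_algebra.
From mathcomp Require Import all_classical all_reals all_analysis.
From mathcomp Require Import lra ring.

Set Implicit Arguments.
Unset Strict Implicit.
Unset Printing Implicit Defensive.
Import Order.TTheory GRing.Theory Num.Theory.

Local Open Scope classical_set_scope.
Local Open Scope ring_scope.

(** Fix pairwise disjoint blocks of vertices B_0, B_1, ... in S, where B_n has
N = n + 1 elements, and a function m with 0 < m n <= N.  Let K1 consist of all
non-empty subsets of the blocks, and K2 of those with at most m n elements when
contained in B_n.

Since K2 is a subcomplex of K1, only delta K1 K2 matters, and it is the
supremum over n of 1 - m n / N.
- A map f supported on B_n has total mass 1 spread over N values, so some m n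
  of them carry mass at least m n / N ([heavy_subset]); redirecting the
  remaining values of f into this set gives an element of L K2 at distance at
  most 1 - m n / N from f ([approximation]).
- If f takes each of the N values of B_n with mass 1 / N ([exists_uniform]), an
  element of L K2 can agree with f on at most m n of these values, because its
  essential image meets B_n in at most m n points: if it lies in another block,
  disjointness leaves no point at all.  Hence its distance to f is at least
  1 - m n / N ([separation]).

Each of these numbers is rational, but their supremum can be any alpha of
[0, 1]: take for m n an integer of [1, N] with
(1 - alpha) N <= m n <= (1 - alpha) N + 1, so that 1 - m n / N <= alpha with an
error of at most 1 / N ([dist_block_complex]). *)

(** * A subset carrying its share of the mass *)

(** Starting from the full set, remove a lightest element until m remain: a
lightest element weighs at most the average, so the average weight never
decreases. *)
Lemma heavy_subset (R : realFieldType) (I : finType) (w : I -> R) (m : nat) :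
  (m <= #|I|)%N ->
  exists2 A : {set I}, #|A| = m &
    m%:R * \sum_i w i <= #|I|%:R * \sum_(i in A) w i.
Proof.
move=> mI; rewrite -(subKn mI); have := leq_subr m #|I|.
elim: (#|I| - m)%N => [_|k IH kI].
  rewrite subn0; exists [set: I]%SET; first by rewrite cardsT.
  by under [X in _ <= _ * X]eq_bigl do rewrite inE.
have [A cA le_A] := IH (ltnW kI).
rewrite subnS; set p := (#|I| - k)%N in cA le_A *.
have p0 : (0 < p)%N by rewrite subn_gt0.
have [x0 x0A] : exists x, x \in A by apply/set0Pn; rewrite -card_gt0 cA.
case: (arg_minP w x0A) => x xA min_x; have {}xA : x \in A by exact: xA.
exists (A :\ x)%SET; first by rewrite -cA (cardsD1 x A) xA.
have AE : \sum_(i in A) w i = w x + \sum_(i in (A :\ x)%SET) w i.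
  by rewrite (big_setD1 x).
have light : p%:R * w x <= \sum_(i in A) w i.
  rewrite -cA mulr_natl -sumr_const; exact: ler_sum.
have pE : p%:R = p.-1%:R + 1 :> R by rewrite natr1 prednK.
have p1 : 0 <= p.-1%:R :> R by [].
rewrite -(@ler_pM2l _ p%:R) ?ltr0n//.
have N0 : 0 <= #|I|%:R :> R by [].
move: (ler_wpM2l p1 le_A) (ler_wpM2l N0 light) => h1 h2.
rewrite AE in h1 h2.
rewrite pE in h1 h2 *; nra.
Qed.

(** * The probability space *)

Lemma lambdaT (R : realType) : lambda R setT = 1%E.
Proof.
rewrite /lambda /mrestr setTI.
have := @lebesgue_measure_itv R `[0, 1]; rewrite /= lte_fin ltr01 sube0.
exact.
Qed.

(** Monotonicity comes from the outer measure, so that the set on which two maps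
differ can be compared directly with the preimage of a set of vertices. *)
Lemma lambda_ae_le (R : realType) (A B : set (lebesgueR R)) :
  (\forall t \ae lambda R, A t -> B t) -> (lambda R A <= lambda R B)%E.
Proof.
move=> AB; rewrite (@lambda_ae_eq _ A (A `&` B)).
  by rewrite /lambda /mrestr; apply: le_outer_measure; apply: setSI.
by apply: filterS AB => t AB; split=> [At|[]//]; split=> //; exact: AB.
Qed.

Lemma lambda_fin (R : realType) (A : set (lebesgueR R)) :
  lambda R A \is a fin_num.
Proof.
rewrite ge0_fin_numE; last exact: outer_measure_ge0.
rewrite (@le_lt_trans _ _ 1%E) ?ltry// -lambdaT.
by apply: lambda_ae_le; apply: nearW.
Qed.

Lemma measurable_fiber (R : realType) (S : pointedType)
    (f : {mfun lebesgueR R >-> discrete S}) (Z : set S) :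
  measurable (f @^-1` Z).
Proof. by apply: measurable_funPTI. Qed.

Lemma lambda_preimageC (R : realType) (S : pointedType)
    (f : {mfun lebesgueR R >-> discrete S}) (Z : set S) :
  lambda R (f @^-1` (~` Z)) = (1 - lambda R (f @^-1` Z))%E.
Proof.
have mu : measurable (f @^-1` Z) by exact: measurable_fiber.
rewrite -lambdaT -(setvU (f @^-1` Z)) measureU//; last 2 first.
- exact: measurableC.
- exact: setICl.
by rewrite -preimage_setC addeK// lambda_fin.
Qed.

Lemma lambda_preimage_sum (R : realType) (S : pointedType)
    (f : {mfun lebesgueR R >-> discrete S}) (n : nat) (e : 'I_n -> S)
    (A : {set 'I_n}) :
  injective e ->
  lambda R (f @^-1` (e @` [set` A])) =
    (\sum_(i in A) lambda R (f @^-1` [set e i]))%E.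
Proof.
move=> e_inj; rewrite -measure_bigsetU_ord_cond.
- congr (lambda R _); rewrite -bigcup_pred.
  apply/seteqP; split=> [t [i Ai eft]|t [i Ai /= eft]]; exists i => //.
- by move=> i _; exact: measurable_fiber.
- by move=> i j _ _ [t [/= -> /e_inj]].
Qed.

Lemma lambda_interval_le (R : realType) (a b : R) (A : set (lebesgueR R)) :
  a <= b -> A `&` `[0, 1] `<=` `[a, b] -> (lambda R A <= (b - a)%:E)%E.
Proof.
move=> ab sA; have := @lebesgue_measure_itv R `[a, b]; rewrite /= lte_fin.
have -> : (if a < b then (b%:E - a%:E)%E else 0%E) = (b - a)%:E.
  by case: ltgtP ab => // ->; rewrite subrr.
by move<-; rewrite /lambda /mrestr; apply: le_outer_measure.
Qed.

(** The map is t |-> e (floor (N t)) on [0, 1[, with N = n + 1.  The upper bound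
on the fibers suffices, since they have total mass 1. *)
Lemma exists_uniform (R : realType) (S : pointedType) (n : nat)
    (e : 'I_n.+1 -> S) (e_inj : injective e) :
  exists f : {mfun lebesgueR R >-> discrete S},
    (forall t, range e (f t)) /\
    forall i, (lambda R (f @^-1` [set e i]) <= (n.+1%:R^-1)%:E)%E.
Proof.
(* The minimum sends t = 1 to the last value, and keeps the index in range for
   t outside [0, 1]. *)
pose h (t : R) : nat := minn n (`|Num.floor (n.+1%:R * t)|)%N.
pose f (t : lebesgueR R) : discrete S := e (inord (h t)).
have hE (t : R) k : Num.floor (n.+1%:R * t) = k ->
    k%:~R / n.+1%:R <= t < (k + 1)%:~R / n.+1%:R.
  move=> <-; rewrite ler_pdivrMr// ltr_pdivlMr// mulrC.
  by rewrite ge_floor floorD1_gt.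
have mf : measurable_fun setT f.
  move=> _ Y _; rewrite setTI.
  pose D := [set k : int | Y (e (inord (minn n `|k|%N)))].
  rewrite (_ : f @^-1` Y = \bigcup_(k in D)
     `[k%:~R / n.+1%:R, (k + 1)%:~R / n.+1%:R[%classic); last first.
    apply/seteqP; split=> [t Yt|t [k Yk]].
      exists (Num.floor (n.+1%:R * t)) => //=.
      by rewrite in_itv/=; exact: hE.
    rewrite /= in_itv/= ler_pdivrMr// ltr_pdivlMr// mulrC => kt.
    by rewrite /f /h (floor_def kt).
  rewrite bigcup_mkcond.
  apply: countable_bigcupT_measurable => [|k]; first exact: countableP.
  case: ifP => _; last exact: measurable0.
  apply: sub_caratheodory.
  exact: (@measurable_itv R `[_, _[).
pose F : {mfun lebesgueR R >-> discrete S} :=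
  HB.pack f (isMeasurableFun.Build _ _ _ _ f mf).
exists F; split=> [t|i]; first by exists (inord (h t)).
have -> : n.+1%:R^-1 = (i%:R + 1) / n.+1%:R - i%:R / n.+1%:R :> R by field.
apply: lambda_interval_le.
  by rewrite ler_pM2r ?invr_gt0 ?ltr0n// lerDl.
move=> t [/= /e_inj ti]; rewrite !in_itv/= => /andP[t0 t1].
have {ti}ti : h t = i :> nat.
  by rewrite -ti inordK// ltnS geq_minl.
have := hE t _ erefl; move: ti; rewrite /h.
have : 0 <= Num.floor (n.+1%:R * t) by rewrite floor_ge0 mulr_ge0.
case: (Num.floor _) => // k _ /=; rewrite -natr1 => ik /andP[kt tk].
have ik' : (i <= k)%N by rewrite -ik geq_minr.
apply/andP; split.
  by apply: le_trans kt; rewrite ler_pM2r ?invr_gt0 ?ltr0n// ler_nat.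
(* On [0, 1] the last fiber may also contain the endpoint 1; this is why fibers
   are compared with closed intervals. *)
move: ik; case: (leqP n k) => [nk|kn] ik.
  by rewrite -ik natr1 divff.
apply/ltW/(lt_le_trans tk).
by rewrite ler_pM2r ?invr_gt0 ?ltr0n// -ik intrD.
Qed.

(** * Complexes made of disjoint blocks *)

Definition block_image (S : Type) (v : nat -> nat -> S) (n : nat)
    (A : {set 'I_n.+1}) : set S :=
  (fun i : 'I_n.+1 => v n i) @` [set` A].

(** Inside block number n, the faces are the non-empty sets of at most m n
vertices; the bound is expressed by inclusion in the image of a set of indices,
which makes closure under subsets immediate. *)
Program Definition block_complex (S : Type) (v : nat -> nat -> S)
    (m : nat -> nat) (m_gt0 : forall n, (0 < m n)%N) : simplicial_complex S :=
  @SimplicialComplex S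
    [set F | F !=set0 /\
      exists n (A : {set 'I_n.+1}), (#|A| <= m n)%N /\ F `<=` block_image v A]
    _ _ _ _.
Next Obligation.
move=> S v m m_gt0; exists [set v 0%N 0%N]; split; first by exists (v 0%N 0%N).
exists 0%N, [set ord0]%SET; split; first by rewrite cards1.
by move=> _ ->; exists ord0 => //=; rewrite inE.
Qed.
Next Obligation.
move=> S v m m_gt0 F [_ [n [A [_ FA]]]]; apply: sub_finite_set FA _.
exact/finite_image/finite_finset.
Qed.
Next Obligation. by move=> S v m m_gt0 F []. Qed.
Next Obligation.
move=> S v m m_gt0 F G [_ [n [A [cA FA]]]] GF G0; split => //.
by exists n, A; split=> //; exact: subset_trans FA.
Qed.

Definition Lmap_class (R : realType) (S : pointedType)
    (g : {mfun lebesgueR R >-> discrete S}) : Lmap R S :=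
  \pi_(Lmap R S)%qT g.

(** The coercion to functions chooses a representative of the class, which may
differ from g on a null set. *)
Lemma Lmap_class_ae_eq (R : realType) (S : pointedType)
    (g : {mfun lebesgueR R >-> discrete S}) :
  Lmap_class g = g %[ae lambda R].
Proof.
apply/asboolP.
have : (repr (Lmap_class g) == g %[mod Lmap R S])%qT by rewrite reprK.
by rewrite eqmodE.
Qed.

(** With finitely many values, those attained on a null set are attained on a
null set altogether.  So almost everywhere a value is essential, and in
particular the essential image is not empty. *)
Lemma in_L_of_finite_range (R : realType) (S : pointedType)
    (K : simplicial_complex S) (n : nat) (e : 'I_n -> S) (A : {set 'I_n})
    (g : {mfun lebesgueR R >-> discrete S}) :
  injective e ->
  (forall G, G !=set0 -> G `<=` e @` [set` A] -> faces K G) ->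
  (forall t, (e @` [set` A]) (g t)) ->
  L K (Lmap_class g).
Proof.
move=> e_inj KA gA.
have ess_ae : {ae lambda R, forall t, essential_image g (g t)}.
  pose B := [set i in A | lambda R (g @^-1` [set e i]) == 0%E]%SET.
  exists (g @^-1` (e @` [set` B])); split.
  - exact: measurable_fiber.
  - apply: etrans (lambda_preimage_sum g B e_inj) _.
    by apply: big1 => i; rewrite inE => /andP[_ /eqP].
  - move=> t /= nt; have [i iA eit] := gA t; exists i => //=.
    rewrite inE; apply/andP; split; first exact: iA.
    rewrite eq_le; apply/andP; split; last exact: outer_measure_ge0.
    by rewrite leNgt; apply/negP => pos; apply: nt; rewrite -eit.
have ess0 : essential_image g !=set0.
  apply/set0P/negP => /eqP ess0.
  have : (lambda R setT <= lambda R set0)%E.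
    by apply: lambda_ae_le; apply: filterS ess_ae => t; rewrite ess0.
  by rewrite measure0 lambdaT lee_fin ler10.
rewrite /L /= (essential_image_ae_eq (Lmap_class_ae_eq g)); split.
  apply: KA => // s s_pos; apply: contrapT => sA.
  have : (0 < lambda R (g @^-1` [set s]))%E by [].
  rewrite (_ : g @^-1` [set s] = set0) ?measure0 ?ltxx//.
  by rewrite -subset0 => t /= gts; apply: sA; rewrite -gts; exact: gA.
by apply: filterS2 (Lmap_class_ae_eq g) ess_ae => t /= ->.
Qed.

Definition block_injective (S : Type) (v : nat -> nat -> S) : Prop :=
  forall n i n' i', v n i = v n' i' -> n = n' /\ i = i'.

Lemma block_ord_inj (S : Type) (v : nat -> nat -> S) (n : nat) :
  block_injective v -> injective (fun i : 'I_n.+1 => v n i).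
Proof. by move=> v_inj i j /v_inj[_ /val_inj]. Qed.

(** * The distance between block complexes *)

(** The approximating map keeps the values of f lying in a heaviest possible
set of m2 n vertices, and sends all others to one vertex of this set. *)
Lemma approximation (R : realType) (S : pointedType) (v : nat -> nat -> S)
    (v_inj : block_injective v) (m1 m2 : nat -> nat)
    (m1_gt0 : forall n, (0 < m1 n)%N) (m2_gt0 : forall n, (0 < m2 n)%N)
    (m2_le : forall n, (m2 n <= n.+1)%N)
    (alpha : R) (m2_ge : forall n, (1 - alpha) * n.+1%:R <= (m2 n)%:R)
    (f : Lmap R S) :
  L (block_complex v m1_gt0) f ->
  exists2 g : Lmap R S, L (block_complex v m2_gt0) g &
    (dist_map f g <= alpha%:E)%E.
Proof.
move=> [[_ [n [A1 [_ fA1]]]] f_ae].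
have e_inj := @block_ord_inj S v n v_inj.
set e := (fun i : 'I_n.+1 => v n i) in e_inj.
pose w (i : 'I_n.+1) : R := fine (lambda R (f @^-1` [set e i])).
have wE (A : {set 'I_n.+1}) :
    lambda R (f @^-1` (e @` [set` A])) = (\sum_(i in A) w i)%:E.
  rewrite (lambda_preimage_sum (repr f) A e_inj) -sumEFin.
  by apply: eq_bigr => i _; rewrite fineK// lambda_fin.
(* Almost every value of f is essential, hence lies in the block. *)
have w1 : \sum_i w i = 1.
  apply: EFin_inj; rewrite -lambdaT.
  rewrite (eq_bigl (fun i => i \in [set: 'I_n.+1]%SET)); last first.
    by move=> i; rewrite inE.
  rewrite -wE; apply: lambda_ae_eq; apply: filterS f_ae => t ft.
  split=> // _; have [i _ eit] := fA1 _ ft.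
  by exists i => //=; rewrite inE.
have [A cA leA] := @heavy_subset R 'I_n.+1 w (m2 n) ltac:(by rewrite card_ord).
rewrite w1 mulr1 card_ord in leA.
have [a aA] : exists a, a \in A by apply/set0Pn; rewrite -card_gt0 cA.
pose Z := e @` [set` A].
pose g0 (t : lebesgueR R) : discrete S := if f t \in Z then f t else e a.
have mg0 : measurable_fun setT g0.
  move=> _ Y _; rewrite setTI.
  pose Y' : set S := [set s | Y (if s \in Z then s else e a)].
  rewrite (_ : g0 @^-1` Y =
    (repr f : {mfun lebesgueR R >-> discrete S}) @^-1` Y') //.
  exact: measurable_fiber.
pose G : {mfun lebesgueR R >-> discrete S} :=
  HB.pack g0 (isMeasurableFun.Build _ _ _ _ g0 mg0).
exists (Lmap_class G).
  apply: (in_L_of_finite_range e_inj (A := A)).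
    by move=> F F0 FA; split=> //; exists n, A; rewrite cA.
  move=> t; rewrite /G/= /g0; case: ifPn => [/set_mem//|_]; by exists a.
have -> : dist_map f (Lmap_class G) = dist_map f G.
  by apply: dist_map_ae_eq; [exact: ae_eq_refl | exact: Lmap_class_ae_eq].
apply: (@le_trans _ _ (lambda R (f @^-1` (~` Z)))).
  apply: lambda_ae_le; apply: nearW => t /= fG Zt; apply: fG.
  by rewrite /G /= /g0 mem_set.
apply: (@le_trans _ _ (1 - lambda R (f @^-1` Z))%E).
  by rewrite (lambda_preimageC (repr f)).
rewrite wE -EFinB lee_fin lerBlDl -lerBlDr.
rewrite -(@ler_pM2r _ n.+1%:R) ?ltr0n// (le_trans (m2_ge n))//.
by rewrite (le_trans leA)// mulrC.
Qed.

(** The hypothesis on m1 makes every whole block a face of the first complex,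
so that it admits the uniform map on block n. *)
Lemma separation (R : realType) (S : pointedType) (v : nat -> nat -> S)
    (v_inj : block_injective v) (m1 m2 : nat -> nat)
    (m1_gt0 : forall n, (0 < m1 n)%N) (m2_gt0 : forall n, (0 < m2 n)%N)
    (m1_ge : forall n, (n.+1 <= m1 n)%N) (n : nat) :
  exists2 f : Lmap R S, L (block_complex v m1_gt0) f &
    forall g : Lmap R S, L (block_complex v m2_gt0) g ->
      ((1 - (m2 n)%:R / n.+1%:R)%:E <= dist_map f g)%E.
Proof.
have e_inj := @block_ord_inj S v n v_inj.
set e := (fun i : 'I_n.+1 => v n i) in e_inj.
have [f [f_range f_le]] := @exists_uniform R S n e e_inj.
exists (Lmap_class f).
  apply: (in_L_of_finite_range e_inj (A := [set: 'I_n.+1]%SET)).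
    move=> F F0 FA; split=> //; exists n, [set: 'I_n.+1]%SET.
    by rewrite cardsT card_ord.
  by move=> t; have [i _ <-] := f_range t; exists i => //=; rewrite inE.
move=> g [[_ [n' [A' [cA' gA']]]] g_ae].
have -> : dist_map (Lmap_class f) g = dist_map f g.
  by apply: dist_map_ae_eq; [exact: Lmap_class_ae_eq | exact: ae_eq_refl].
(* Either the essential image of g lies in block n, or in a block disjoint
   from it. *)
have [A cA gA] : exists2 A : {set 'I_n.+1}, (#|A| <= m2 n)%N &
    essential_image g `&` range e `<=` e @` [set` A].
  have [n'n|n'n] := eqVneq n' n.
    by subst n'; exists A' => // s [/gA'].
  exists (finset.set0); first by rewrite cards0.
  by move=> _ [/gA'[i' _ <-] [i _ /v_inj[nn' _]]]; rewrite nn' eqxx in n'n.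
apply: (@le_trans _ _ (lambda R (f @^-1` (~` (e @` [set` A]))))); last first.
  apply: lambda_ae_le; apply: filterS g_ae => t gt /= fA fg; apply: fA.
  by apply: gA; split; [rewrite fg | exact: f_range].
rewrite lambda_preimageC (lambda_preimage_sum f A e_inj) EFinB leeB//.
apply: (@le_trans _ _ (\sum_(i in A) (n.+1%:R^-1)%:E)%E).
  by apply: lee_sum => i _; exact: f_le.
rewrite sumEFin lee_fin sumr_const -[leLHS]mulr_natl.
by rewrite ler_pM2r ?invr_gt0 ?ltr0n// ler_nat.
Qed.

(** The two bounds on m say that 1 - m n / (n + 1) is at most alpha and at
least alpha - 1 / (n + 1), hence that its supremum over n is alpha. *)
Lemma dist_block_complex (R : realType) (S : pointedType) (v : nat -> nat -> S)
    (v_inj : block_injective v) (m : nat -> nat)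
    (m_gt0 : forall n, (0 < m n)%N) (m_le : forall n, (m n <= n.+1)%N)
    (alpha : R) (alpha_ge0 : 0 <= alpha)
    (m_ge : forall n, (1 - alpha) * n.+1%:R <= (m n)%:R)
    (m_le_add1 : forall n, (m n)%:R <= (1 - alpha) * n.+1%:R + 1) :
  dist R (block_complex v ltn0Sn) (block_complex v m_gt0) = alpha%:E.
Proof.
set K1 := block_complex _ ltn0Sn; set K2 := block_complex _ m_gt0.
have d12_le : (@delta R S K1 K2 <= alpha%:E)%E.
  apply: ge_ereal_sup => _ [f Lf <-].
  have [g Lg fg] := approximation v_inj m_gt0 m_le m_ge Lf.
  by apply: le_trans fg; apply: ereal_inf_lbound; exists g.
have d21_le : (@delta R S K2 K1 <= alpha%:E)%E.
  apply: ge_ereal_sup => _ [f [[f0 [n [A [cA fA]]]] f_ae] <-].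
  apply: (@le_trans _ _ (dist_map f f)).
    apply: ereal_inf_lbound; exists f => //; split => //.
    by split=> //; exists n, A; split=> //; exact: leq_trans (m_le n).
  rewrite /dist_map (_ : [set t | _] = set0); last first.
    by rewrite -subset0 => t; exact.
  by rewrite measure0 lee_fin.
have d12_ge : (alpha%:E <= @delta R S K1 K2)%E.
  apply/lee_addgt0Pr => eps eps_gt0.
  have [n n_eps] : exists n, n.+1%:R^-1 < eps.
    exists (Num.trunc eps^-1); rewrite invf_plt ?posrE//.
    exact: truncnS_gt.
  have [f Lf f_far] := separation R v_inj ltn0Sn m_gt0 (fun k => leqnn _) n.
  rewrite -leeBlDr//.
  apply: (@le_trans _ _ (ereal_inf [set dist_map f g | g in @L R S K2])).
    2: by apply: ereal_sup_ubound; exists f.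
  apply: le_ereal_inf_tmp => _ [g Lg <-]; apply: le_trans (f_far g Lg).
  rewrite -EFinB lee_fin.
  rewrite lerBlDr addrAC lerBrDr -lerBrDl addrAC.
  apply: (@le_trans _ _ (1 - alpha + n.+1%:R^-1)); last by rewrite lerD2l ltW.
  by rewrite ler_pdivrMr ?ltr0n// mulrDl mulVf//; exact: m_le_add1.
have d12 : @delta R S K1 K2 = alpha%:E by apply/eqP; rewrite eq_le d12_le.
by rewrite /dist d12; exact/max_idPl.
Qed.

Theorem mainTheorem3 (R : realType) (S : pointedType)
    (S_infinite : infinite_set [set: S]) (alpha : R) (alpha01 : 0 <= alpha <= 1) :
  exists K1 K2 : simplicial_complex S, dist R K1 K2 = alpha%:E.
Proof.
have /andP[alpha_ge0 alpha_le1] := alpha01.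
have /infiniteP/pcard_leP[u] := S_infinite.
pose v (n i : nat) := u (pickle (n, i)).
have v_inj : block_injective v.
  move=> n i n' i' /(@inj _ _ _ u) => /(_ (in_setT _) (in_setT _)).
  by move=> /(pcan_inj (@pickleK _))[].
pose x n := (1 - alpha) * n.+1%:R.
(* The successor of the truncation exceeds x n; the minimum only acts when x n
   reaches n + 1, that is when alpha = 0. *)
pose m n := minn n.+1 (Num.trunc (x n)).+1.
have m_gt0 n : (0 < m n)%N by rewrite leq_min.
have x_ge0 n : 0 <= x n by rewrite mulr_ge0// subr_ge0.
have x_le n : x n <= n.+1%:R.
  by rewrite /x ler_piMl// gerBl.
exists (block_complex v ltn0Sn), (block_complex v m_gt0).
apply: dist_block_complex => // n.
- exact: geq_minl.
- have := truncn_itv (x_ge0 n) => /andP[_ lt_x].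
  rewrite -/(x n) /m; case: leqP => _; [exact: x_le | exact: ltW].
- have := truncn_itv (x_ge0 n) => /andP[le_x _].
  rewrite -/(x n) (@le_trans _ _ (Num.trunc (x n)).+1%:R)//.
    by rewrite ler_nat geq_minr.
  by rewrite -natr1 lerD2r.
Qed.
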